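(* Let $C$ be a doubly even self-dual binary linear code of length $N$ with code-lattice $L$, and let $\bar g\in\operatorname{Aut}C$ have even order $m$; let $g=\iota(\bar g)\in\operatorname{Aut}L$. Then the standard lift $\hat g$ of $g$ to the lattice vertex operator algebra $V_L$ does not have order doubling (i.e. $\hat g$ has order $m$ rather than $2m$) if and only if $|B\cap\bar g^{m/2}(B)|\equiv0\pmod4$ for every codeword $B\in C$ (codewords viewed as subsets of $\{1,\dots,N\}$).
   Context: Code-lattice: with $\langle\beta_i,\beta_j\rangle=\tfrac12\delta_{ij}$, $L=\{\sum_ia_i\beta_i:a_i\in\mathbb{Z},(a_i\bmod2)_i\in C\}$; $\iota(\sigma)(\beta_j)=\beta_{\sigma(j)}$ (equivalently, with $\alpha_i=2\beta_i$ of norm $2$, $L$ is the union over $B\in C$ of $\tfrac12\sum_{i\in B}\alpha_i+\bigoplus_i\mathbb{Z}\alpha_i$). $V_L$ is the lattice vertex operator algebra built from the Heisenberg algebra of $L\otimes\mathbb{C}$ and a twisted group algebra $\mathbb{C}_\epsilon[L]$ with basis $\mathfrak e_\alpha$, $\mathfrak e_\alpha\mathfrak e_\beta=\epsilon(\alpha,\beta)\mathfrak e_{\alpha+\beta}$. A lift of $g\in\operatorname{Aut}L$ acts as $g$ on the Heisenberg part and by $\mathfrak e_\alpha\mapsto u(\alpha)\mathfrak e_{g\alpha}$, where $u:L\to\{\pm1\}$ satisfies $\epsilon(\alpha,\beta)/\epsilon(g\alpha,g\beta)=u(\alpha)u(\beta)/u(\alpha+\beta)$; it is standard if $u(\alpha)=1$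 for all $\alpha$ fixed by $g$. Order doubling means the lift has order twice the order of $g$. *)

(* Defs.v *)
From HB Require Import structures.
From mathcomp Require Import all_boot all_order all_fingroup all_algebra.
From mathcomp Require Import finmap reals complex monalg.

Set Implicit Arguments.
Unset Strict Implicit.
Unset Printing Implicit Defensive.

Import Order.TTheory GRing.Theory Num.Theory.
Local Open Scope ring_scope.

(* The order of a self-map under composition. *)
Definition has_order (T : Type) (f : T -> T) (n : nat) : Prop :=
  [/\ (0 < n)%N, iter n f =1 id
    & forall k : nat, (0 < k < n)%N -> ~ (iter k f =1 id)].

(* Coordinates are moved by e_j |-> e_(s j), so x i becomes the coordinate of
   index s i: this is column permutation by the inverse of s. *)
Definition perm_coords (T : Type) (N : nat) (s : 'S_N) (x : 'rV[T]_N) :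
    'rV[T]_N :=
  col_perm (s^-1)%g x.

Section Codes.
Variable N : nat.
Implicit Types (C : {vspace 'rV['F_2]_N}) (c : 'rV['F_2]_N) (s : 'S_N).

Definition supp c : {set 'I_N} := [set i | c 0 i != 0].

Definition doubly_even C : Prop := forall c, c \in C -> (4 %| #|supp c|)%N.

Definition in_dual C (x : 'rV['F_2]_N) : Prop :=
  forall c, c \in C -> \sum_i x 0 i * c 0 i = 0.

Definition self_dual C : Prop := forall x, x \in C <-> in_dual C x.

Definition is_code_aut C s : Prop :=
  forall c, (perm_coords s c \in C) = (c \in C).

End Codes.

Section CodeLattice.
Variables (N : nat) (C : {vspace 'rV['F_2]_N}).

Definition mod2 (a : 'rV[int]_N) : 'rV['F_2]_N := map_mx intr a.

(* The vector \sum_i a_i beta_i is represented by its coordinates a. *)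
Definition in_code_lattice : {pred 'rV[int]_N} := fun a => mod2 a \in C.

Lemma in_code_lattice_zmod : zmod_closed in_code_lattice.
Proof.
have inE x : (x \in in_code_lattice) = (mod2 x \in C) by [].
split=> [|a b]; rewrite !inE /mod2; first by rewrite raddf0 mem0v.
by move=> aC bC; rewrite raddfB memvB.
Qed.

HB.instance Definition _ :=
  GRing.isZmodClosed.Build 'rV[int]_N in_code_lattice in_code_lattice_zmod.

Record code_lattice := CodeLattice {
  code_lattice_val :> 'rV[int]_N;
  _ : code_lattice_val \in in_code_lattice }.

HB.instance Definition _ := [isSub for code_lattice_val].
HB.instance Definition _ := [Choice of code_lattice by <:].
HB.instance Definition _ := [SubChoice_isSubZmodule of code_lattice by <:].

Definition latt_form (a b : code_lattice) : rat :=
  \sum_(i < N) \sum_(j < N)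
    (val a 0 i)%:~R * (val b 0 j)%:~R * ((i == j)%:R / 2).

Section Iota.
Variables (s : 'S_N) (Hs : is_code_aut C s).

Lemma iota_subproof (a : code_lattice) :
  perm_coords s (val a) \in in_code_lattice.
Proof.
have inE x : (x \in in_code_lattice) = (mod2 x \in C) by [].
have -> : (perm_coords s (val a) \in in_code_lattice)
          = (perm_coords s (mod2 (val a)) \in C).
  by rewrite inE; congr (_ \in C); apply/rowP=> i; rewrite !mxE.
by rewrite Hs; exact: (valP a).
Qed.

Definition code_iota (a : code_lattice) : code_lattice :=
  CodeLattice (iota_subproof a).

End Iota.

End CodeLattice.

Section LatticeVOA.
Variables (R : realType) (N : nat) (C : {vspace 'rV['F_2]_N}).
Local Notation L := (code_lattice C).
Implicit Types (eps : L -> L -> R[i]) (u : L -> R[i]) (s : 'S_N).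

(* The cocycle of the twisted group algebra; e_0 is its identity and
   e_a e_b = (-1)^<a,b> e_b e_a. For a self-dual doubly even code <a,b> is
   always an integer. *)
Definition lattice_cocycle eps : Prop :=
  [/\ forall a b, eps a b != 0,
      forall a, eps a 0 = 1 /\ eps 0 a = 1,
      forall a b c, eps a b * eps (a + b) c = eps b c * eps a (b + c)
    & forall (a b : L) (n : int), latt_form a b = n%:~R ->
        eps a b = (-1) ^ n * eps b a].

(* The Fock space of the Heisenberg algebra of L \otimes \C, i.e. the symmetric
   algebra of (L \otimes \C) \otimes t^-1 \C[t^-1]: the vectors
   beta_i = (2 beta_i) / 2 form a basis of L \otimes \C, and the variable
   of index (i, n) is beta_i(-n-1). *)
Definition fock : Type := {malg R[i][{cmonom ('I_N * nat)%type}]}.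
HB.instance Definition _ := GRing.ComNzRing.on fock.
HB.instance Definition _ := GRing.Lmodule.on fock.

Definition heis (i : 'I_N) (n : nat) : fock := << ucm (i, n) >>.

(* The underlying space S(h^-) \otimes \C_eps[L] of V_L; << f *g a >> is
   f \otimes e_a. The malg type is used only as a free module over the basis
   (e_a); no product on it is involved. The order of a lift only depends on the
   linear map it defines on this space, so vertex operators are not needed. *)
Definition voa : Type := {malg fock[L]}.
HB.instance Definition _ := GRing.Zmodule.on voa.

(* The algebra endomorphism beta_i(-n-1) |-> beta_(s i)(-n-1). *)
Definition fock_act s : fock -> fock :=
  mmap (@malgC _ R[i])
    (fun m : {cmonom ('I_N * nat)%type} =>
       \prod_(x <- finsupp m) heis (s x.1) x.2 ^+ m x).

Section Lift.
Variables (eps : L -> L -> R[i]) (s : 'S_N) (Hs : is_code_aut C s).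
Local Notation g := (code_iota Hs).

Definition is_lift_data u : Prop :=
  (forall a, u a = 1 \/ u a = -1) /\
  (forall a b, eps a b / eps (g a) (g b) = u a * u b / u (a + b)).

Definition is_standard u : Prop := forall a, g a = a -> u a = 1.

(* f \otimes e_a |-> (s f) \otimes u(a) e_(g a), extended linearly. *)
Definition voa_lift u : voa -> voa := fun v =>
  \sum_(a <- msupp v) << u a *: fock_act s v@_a *g g a >>.

Definition order_doubling u : Prop :=
  exists n : nat, has_order g n /\ has_order (voa_lift u) (2 * n)%N.

End Lift.

End LatticeVOA.

(* Main.v *)
From HB Require Import structures.
Require Import Defs.
From mathcomp Require Import all_boot all_order all_fingroup all_algebra.
From mathcomp Require Import finmap reals complex monalg.
From mathcomp Require Import cyclic ring.

(* Write n for the order of g and h = n/2. In the twisted group algebra the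
   product P = e_a . (lift e_a) ... (lift^(n-1) e_a) is a multiple of e_b with
   b = a + g a + ... + g^(n-1) a fixed by g, so the standard lift fixes P. On
   the other hand the lift turns P into the cyclically shifted product times
   U(a) = u(a) u(g a) ... u(g^(n-1) a), and moving e_a back to the front costs
   the sign (-1)^<a, g a + ... + g^(n-1) a>. As <a, g^i a> = <a, g^(n-i) a>,
   this gives U(a) = (-1)^<a, g^h a>. The n-th power of the lift multiplies the
   e_a-component by U(a), so order doubling means that some <a, g^h a> is odd.
   Finally 2 <a, g^h a> = \sum_i a_i a_(g^h i) depends modulo 4 only on
   B = a mod 2, because g^h is an involution, and equals |B :&: g^h B|. *)

Set Implicit Arguments.
Unset Strict Implicit.
Unset Printing Implicit Defensive.

Import Order.TTheory GRing.Theory Num.Theory.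
Local Open Scope ring_scope.

(** * Cocycles and lifts along an orbit of [g] *)

Section OrbitSum.
Variables (F : fieldType) (L : zmodType) (g : L -> L).
Hypothesis gD : {morph g : x y / x + y}.
Variables (eps : L -> L -> F) (u : L -> F).
Hypothesis eps_neq0 : forall a b, eps a b != 0.
Hypothesis eps0 : forall a, eps a 0 = 1 /\ eps 0 a = 1.
Hypothesis epsA : forall a b c,
  eps a b * eps (a + b) c = eps b c * eps a (b + c).
Hypothesis u_neq0 : forall a, u a != 0.
Hypothesis u_lift : forall a b,
  eps a b / eps (g a) (g b) = u a * u b / u (a + b).

Lemma orbit_sum_image n a :
  g (\sum_(0 <= i < n) iter i g a) = \sum_(1 <= i < n.+1) iter i g a.
Proof.
have g0 : g 0 = 0 by apply: (addIr (g 0)); rewrite -gD !add0r.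
elim: n => [|n IH]; first by rewrite !big_geq.
by rewrite big_nat_recr //= gD IH [RHS]big_nat_recr.
Qed.

(* Both sides are the coefficient of e_a e_(g a) ... e_(g^n a) in the twisted
   group algebra, bracketed from the left, resp. with e_a split off. *)
Lemma orbit_cocycle n a :
  \prod_(0 <= k < n.+1) eps (\sum_(0 <= i < k) iter i g a) (iter k g a)
  = (\prod_(0 <= k < n)
       eps (\sum_(1 <= i < k.+1) iter i g a) (iter k.+1 g a))
    * eps a (\sum_(1 <= i < n.+1) iter i g a).
Proof.
elim: n => [|n IH].
  by rewrite big_nat1 !big_geq // (eps0 _).1 (eps0 _).2 mulr1.
rewrite big_nat_recr //= {}IH.
rewrite [in RHS]big_nat_recr //= -!mulrA; congr (_ * _).
rewrite [in RHS](big_nat_recr n.+1 1%N) //= -epsA; congr (_ * eps _ _).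
by rewrite big_ltn.
Qed.

(** Unrolls the lift relation one orbit element at a time; [g] of a partial orbit sum is the shifted
    partial sum. *)
Lemma orbit_sum_lift n a :
  u (\sum_(0 <= i < n) iter i g a)
  = \prod_(0 <= k < n) (u (iter k g a)
      * (eps (\sum_(1 <= i < k.+1) iter i g a) (iter k.+1 g a)
         / eps (\sum_(0 <= i < k) iter i g a) (iter k g a))).
Proof.
(* The lift relation at (0, 0), with [g 0 = 0] read off the empty orbit sum. *)
have u0 : u 0 = 1.
  have := u_lift 0 0; have := orbit_sum_image 0 a; rewrite !big_geq // => ->.
  by rewrite addr0 mulfK // divff.
elim: n => [|n IH]; first by rewrite !big_geq.
rewrite [X in u X]big_nat_recr //= [RHS]big_nat_recr //= -{}IH.
rewrite -orbit_sum_image.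
set S := \sum_(_ <= i < _) _; set b := iter n g a.
have -> : u (S + b) = u S * u b / (eps S b / eps (g S) (g b)).
  by rewrite u_lift invf_div mulrCA divff ?mulr1 // mulf_neq0.
by rewrite invf_div !mulrA.
Qed.

Lemma standard_lift_power m a :
  (0 < m)%N -> iter m g a = a -> (forall b, g b = b -> u b = 1) ->
  \prod_(0 <= k < m) u (iter k g a)
  = eps a (\sum_(1 <= i < m) iter i g a) / eps (\sum_(1 <= i < m) iter i g a) a.
Proof.
case: m => // m _ gma u1.
have Sfix : g (\sum_(0 <= i < m.+1) iter i g a) = \sum_(0 <= i < m.+1) iter i g a.
  by rewrite orbit_sum_image big_nat_recr //= -iterS gma addrC [RHS]big_ltn.
have := u1 _ Sfix; rewrite orbit_sum_lift !big_split /= prodfV.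
rewrite orbit_cocycle; set U := \prod_(0 <= k < m.+1) u _.
(* The orbit closes up, so the last factor of the shifted product is [eps T a]; the remaining
   factors form the [P] that [orbit_cocycle] also produced, and they cancel. *)
rewrite [X in _ * (X / _)]big_nat_recr //= -iterS gma.
set P := \prod_(_ <= _ < _) _.
set T := \sum_(_ <= _ < _) _ => UPE.
have P0 : P != 0 by rewrite prodf_seq_neq0; apply/allP => i _; rewrite eps_neq0.
have := eps_neq0 a T; have := eps_neq0 T a => e1 e2.
rewrite -[RHS]mul1r -UPE; field.
by rewrite P0 e1 e2.
Qed.

End OrbitSum.

(** * Orders of self-maps, involutions modulo 4, free modules *)

Lemma has_order_uniq (T : Type) (f : T -> T) m n :
  has_order f m -> has_order f n -> m = n.
Proof.
move=> [m0 fm mmin] [n0 fn nmin]; apply/eqP; rewrite eqn_leq.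
apply/andP; split; rewrite leqNgt; apply/negP => lt.
- by apply: (mmin n) => //; rewrite n0.
- by apply: (nmin m) => //; rewrite m0.
Qed.

Lemma iter_id (T : Type) (f : T -> T) (x : T) n : f x = x -> iter n f x = x.
Proof. by move=> fx; elim: n => //= n ->. Qed.

Lemma has_order_dvd (T : Type) (f : T -> T) m k :
  has_order f m -> iter k f =1 id -> (m %| k)%N.
Proof.
move=> [m0 fm mmin] fk; rewrite /dvdn; apply/negPn/negP => nz.
apply: (mmin (k %% m)%N); first by rewrite lt0n nz ltn_mod.
move=> x; rewrite -[RHS]fk [in RHS](divn_eq k m) addnC iterD.
by rewrite iterM (@iter_id _ (iter m f)).
Qed.

(* Replacing each a_i by its residue mod 2 changes the sum by a multiple of 4:
   the terms 2 c_i b_(s i) and 2 b_i c_(s i) have equal sums since s is an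
   involution. *)
Lemma involution_form_mod4 (I : finType) (s : {perm I}) (a : I -> int) :
  involutive s ->
  (\sum_i a i * a (s i)
   = #|[set i | odd `|a i| && odd `|a (s i)|]|%:Z %[mod 4])%Z.
Proof.
move=> ss; set b := fun i => (odd `|a i|)%:Z.
pose c i := (a i %/ 2)%Z.
have aE i : a i = b i + c i * 2.
  rewrite [LHS](divz_eq (a i) 2) addrC; congr (_ + _).
  rewrite /b; case: (a i) => n; first by rewrite modz_nat modn2.
  by rewrite NegzE abszN oddS -NegzE modNz_nat // modn2; case: odd.
have -> : (#|[set i | odd `|a i| && odd `|a (s i)|]|)%:Z = \sum_i b i * b (s i).
  rewrite cardsE -sum1_card -natz natr_sum big_mkcond /=; apply: eq_bigr => i _.
  by rewrite unfold_in /b; do 2 case: odd.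
suff -> : \sum_i a i * a (s i) = \sum_i b i * b (s i) +
    4 * (\sum_i (b i * c (s i) + c i * c (s i))).
  by rewrite mulrC addrC modzMDl.
have sym : \sum_i c i * b (s i) = \sum_i b i * c (s i).
  rewrite (reindex_inj (@perm_inj _ s)) /=; apply: eq_bigr => i _.
  by rewrite ss mulrC.
rewrite (_ : 4 * _ = 2 * (\sum_i b i * c (s i)) + 2 * \sum_i c i * b (s i)
                     + 4 * \sum_i c i * c (s i)); last first.
  by rewrite sym big_split /=; ring.
rewrite !mulr_sumr -!big_split /=; apply: eq_bigr => i _.
by rewrite 2!aE; ring.
Qed.

Lemma malgZU (K : choiceType) (A : nzRingType) (c : A) (k : K) :
  c *: << k >> = << c *g k >> :> {malg A[K]}.
Proof.
by apply/malgP => j; rewrite mcoeffZ !mcoeffU mulr_natr.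
Qed.

Lemma malg_scale1_inj (K : monomType) (A : nzRingType) (c : A) (n : nat) :
  c *: 1 = 1 *+ n :> {malg A[K]} -> c = n%:R.
Proof.
move=> /(congr1 (mcoeff mone)).
by rewrite mcoeffZ mcoeffMn mcoeff1 eqxx mulr1.
Qed.

(** * Permutations acting on the Fock space *)

Section FockAct.
Variables (R : realType) (N : nat).
Implicit Types (s t : 'S_N) (m : {cmonom ('I_N * nat)%type}).
Local Notation fock := (fock R N).

(** Isolated from [fock_act] so that it can carry a multiplicative structure, which makes
    [fock_act s] a ring morphism. *)
Definition fock_monom_act s m : fock :=
  \prod_(x <- finsupp m) heis R (s x.1) x.2 ^+ m x.

(** Variables outside the support contribute exponent 0, so two monomials can be expanded over a
    common index set. *)
Lemma fock_monom_actE (d : {fset ('I_N * nat)%type}) s m :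
  (finsupp m `<=` d)%fset ->
  fock_monom_act s m = \prod_(x <- d) heis R (s x.1) x.2 ^+ m x.
Proof.
move=> le_md; rewrite /fock_monom_act (big_fset_incl _ le_md) //= => x _.
by rewrite -cmE_eq0 => /eqP ->; rewrite expr0.
Qed.

Lemma fock_monom_act_morph s : mmorphism (fock_monom_act s).
Proof.
split=> [m1 m2|]; last by rewrite /fock_monom_act mdom1 big_seq_fset0.
rewrite (@fock_monom_actE (finsupp m1 `|` finsupp m2)%fset); last first.
  by rewrite mdomD.
rewrite (fock_monom_actE _ (fsubsetUl (finsupp m1) (finsupp m2))).
rewrite (fock_monom_actE _ (fsubsetUr (finsupp m1) (finsupp m2))) -big_split /=.
by apply: eq_bigr => x _; rewrite cmM exprD.
Qed.

HB.instance Definition _ s :=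
  isMultiplicative.Build _ _ (fock_monom_act s) (fock_monom_act_morph s).

Lemma fock_act_mmap s :
  fock_act (R:=R) s = mmap (@malgC _ R[i]) (fock_monom_act s).
Proof. by []. Qed.

Lemma fock_actZ s c f : fock_act s (c *: f) = c *: fock_act (R:=R) s f.
Proof. by rewrite fock_act_mmap mmapZ /= mul_malgC. Qed.

Lemma fock_act_heis s i n : fock_act s (heis R i n) = heis R (s i) n.
Proof.
rewrite fock_act_mmap /heis mmapU /fock_monom_act mdomU big_seq_fset1 /=.
by rewrite cmUU expr1 mul1r.
Qed.

Lemma fock_monom_actM s t m :
  fock_act s (fock_monom_act t m) = fock_monom_act (t * s)%g m.
Proof.
rewrite fock_act_mmap rmorph_prod; apply: eq_bigr => x _.
by rewrite rmorphXn /= -fock_act_mmap fock_act_heis permM.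
Qed.

Lemma fock_actE s f :
  fock_act s f = \sum_(m <- msupp f) f@_m *: fock_monom_act s m :> fock.
Proof.
by rewrite fock_act_mmap mmapE; apply: eq_bigr => m _; rewrite mul_malgC.
Qed.

Lemma fock_act0 s : fock_act s 0 = 0 :> fock.
Proof. exact: (raddf0 (mmap (@malgC _ R[i]) (fock_monom_act s))). Qed.

Lemma fock_act_one s : fock_act s 1 = 1 :> fock.
Proof. exact: (@mmap1 _ _ _ _ (fock_monom_act s)). Qed.

Lemma fock_act_sum s (I : Type) (r : seq I) (F : I -> fock) :
  fock_act s (\sum_(i <- r) F i) = \sum_(i <- r) fock_act s (F i).
Proof. exact: (raddf_sum (mmap (@malgC _ R[i]) (fock_monom_act s))). Qed.

Lemma fock_actM s t f :
  fock_act s (fock_act t f) = fock_act (t * s)%g f :> fock.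
Proof.
rewrite [fock_act t f]fock_actE fock_act_sum [RHS]fock_actE.
by apply: eq_bigr => m _; rewrite fock_actZ fock_monom_actM.
Qed.

(** Evaluation at a variable [j] turns the product into a sum with at most one nonzero term, [m j].
    The factorisation reduces [fock_monom_act1] to single variables. *)
Lemma cmonomE m :
  m = \big[mmul/mone]_(x <- finsupp m) iter (m x) (mmul (ucm x)) mone.
Proof.
apply/eqP/cmP => j; pose ev (n : {cmonom ('I_N * nat)%type}) := n j.
rewrite -[RHS]/(ev _) (big_morph ev (cmM j) (cm1 j)).
have evX x k : ev (iter k (mmul (ucm x)) mone) = (k * (x == j))%N.
  by elim: k => [|k IH] /=; rewrite /ev ?cm1 // cmM cmU -/(ev _) IH mulSn.
rewrite (eq_bigr _ (fun x _ => evX x (m x))).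
have [jm|jm] := boolP (j \in finsupp m).
  rewrite (big_fsetD1 j jm) /= eqxx muln1 big1_seq ?addn0 // => x.
  by rewrite in_fsetD1 => /andP[_ /andP[/negPf -> _]]; rewrite muln0.
rewrite big1_seq => [|x /andP[_ xm]]; first by apply/eqP; rewrite cmE_eq0.
by case: eqP jm => [<-|]; rewrite ?xm // muln0.
Qed.

Lemma fock_monom_act1 m : fock_monom_act 1%g m = << m >>.
Proof.
have UM : {morph (fun m => << m >> : fock) : m1 m2 / mmul m1 m2 >-> m1 * m2}.
  by move=> m1 m2; rewrite malgM_def fgmulUU mulr1.
rewrite [in RHS](cmonomE m) (big_morph _ UM (erefl _)).
apply: eq_bigr => -[i n] _; rewrite perm1 /heis [in ucm _]/=.
move: (m _) => k; elim: k => [|k IH]; first by rewrite expr0.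
by rewrite iterS UM exprS IH.
Qed.

Lemma fock_act1 f : fock_act 1%g f = f :> fock.
Proof.
rewrite fock_actE [RHS]monalgE; apply: eq_bigr => m _.
rewrite fock_monom_act1; exact: malgZU.
Qed.

Lemma iter_fock_act s k f : iter k (fock_act s) f = fock_act (s ^+ k)%g f :> fock.
Proof.
elim: k => [|k IH] /=; first by rewrite expg0 fock_act1.
rewrite IH fock_actM expgSr; reflexivity.
Qed.

End FockAct.

(** * The bilinear form and the isometry [g] in coordinates *)

Section CodeLatticeForm.
Variables (N : nat) (C : {vspace 'rV['F_2]_N}).
Local Notation L := (code_lattice C).
Implicit Types a b : L.

(** Twice the lattice pairing, which keeps the computations in the integers. *)
Definition int_form a b : int := \sum_i val a 0 i * val b 0 i.

Lemma latt_formE a b : latt_form a b = (int_form a b)%:~R / 2.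
Proof.
rewrite /latt_form /int_form rmorph_sum mulr_suml; apply: eq_bigr => i _.
rewrite (bigD1 i) //= big1 ?addr0 => [|j /negPf]; last first.
  by rewrite eq_sym => ->; rewrite mul0r mulr0.
by rewrite eqxx mul1r rmorphM.
Qed.

Lemma int_formC a b : int_form a b = int_form b a.
Proof. by apply: eq_bigr => i _; rewrite mulrC. Qed.

Lemma code_lattice_val_sum (I : Type) (r : seq I) (F : I -> L) :
  val (\sum_(i <- r) F i) = \sum_(i <- r) val (F i).
Proof. exact: raddf_sum. Qed.

Lemma int_form_sumr a (I : Type) (r : seq I) (F : I -> L) :
  int_form a (\sum_(i <- r) F i) = \sum_(i <- r) int_form a (F i).
Proof.
rewrite /int_form exchange_big /=; apply: eq_bigr => i _.
by rewrite code_lattice_val_sum summxE mulr_sumr.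
Qed.

Lemma mod2_eq0 (z : int) : (z%:~R == 0 :> 'F_2) = (2 %| z)%Z.
Proof. by rewrite (dvdz_pcharf (pchar_Fp (isT : prime 2))). Qed.

(** Codewords are mutually orthogonal over ['F_2]; hence the lattice is integral. *)
Lemma int_form_even (C_dual : self_dual C) a b : (2 %| int_form a b)%Z.
Proof.
rewrite -mod2_eq0 rmorph_sum /=; apply/eqP.
have /C_dual/(_ _ (valP b : mod2 (val b) \in C)) : mod2 (val a) \in C.
  exact: valP a.
by move=> E; rewrite -[RHS]E; apply: eq_bigr => i _; rewrite !mxE rmorphM.
Qed.

Variables (s : 'S_N) (Hs : is_code_aut C s).
Local Notation g := (code_iota Hs).

Lemma code_iotaD : {morph g : a b / a + b}.
Proof.
by move=> a b; apply: val_inj; rewrite raddfD; apply/rowP => i; rewrite !mxE.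
Qed.

Lemma iter_code_iota k a i :
  val (iter k g a) 0 i = val a 0 ((s ^+ k)^-1%g i).
Proof.
elim: k a i => [|k IH] a i; first by rewrite expg0 invg1 perm1.
by rewrite iterS /= mxE IH expgSr invMg permM.
Qed.

Lemma int_form_iter k a b : int_form (iter k g a) (iter k g b) = int_form a b.
Proof.
rewrite /int_form (reindex_inj (@perm_inj _ (s ^+ k)%g)) /=.
by apply: eq_bigr => i _; rewrite !iter_code_iota permK.
Qed.

(** These vectors reduce to the zero codeword. They serve as test vectors from which a power of [s]
    can be recovered, so that [g] has the order of [s]. *)
Lemma code_lattice_twice (i : 'I_N) : 2 *: delta_mx 0 i \in in_code_lattice C.
Proof.
rewrite /in_code_lattice unfold_in (_ : mod2 _ = 0) ?mem0v //.
by apply/rowP => j; rewrite !mxE intrM (_ : 2%:~R = 0) ?mul0r //; apply/val_inj.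
Qed.

Lemma iter_code_iota_id k : iter k g =1 id -> (s ^+ k)%g = 1%g.
Proof.
move=> gk; apply/permP => i; rewrite perm1.
have := congr1 (fun x : L => val x 0 ((s ^+ k)%g i))
               (gk (CodeLattice (code_lattice_twice i))).
rewrite /= iter_code_iota permK !mxE !eqxx /= mulr1.
by case: eqP.
Qed.

Lemma iter_code_iota_order : iter #[s]%g g =1 id.
Proof.
move=> a; apply/val_inj/rowP => i.
by rewrite iter_code_iota expg_order invg1 perm1.
Qed.

Lemma code_iota_has_order : has_order g #[s]%g.
Proof.
split=> [//||k /andP[k0 km] /iter_code_iota_id sk].
  exact: iter_code_iota_order.
by have := order_dvdn s k; rewrite sk eqxx => /(dvdn_leq k0); rewrite leqNgt km.
Qed.

Lemma int_form_involution h a : ((s ^+ h) ^+ 2 = 1)%g ->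
  (int_form a (iter h g a)
   = #|supp (mod2 (val a)) :&: (s ^+ h)%g @: supp (mod2 (val a))|%:Z %[mod 4])%Z.
Proof.
move=> s2; set t := (s ^+ h)%g.
(* Coordinates of translates are indexed through the inverse permutation, which is [t] again. *)
have tV : (t^-1 = t)%g by apply/eqP; rewrite eq_invg_mul -expg2 s2.
have tt : involutive t by move=> i; rewrite -permM -expg2 s2 perm1.
have -> : int_form a (iter h g a) = \sum_i val a 0 i * val a 0 (t i).
  by apply: eq_bigr => i _; rewrite iter_code_iota -/t tV.
rewrite (involution_form_mod4 (fun i => val a 0 i) tt); congr ((_ %:Z) %% _)%Z.
apply: eq_card => i; rewrite in_setI.
have -> : i \in t @: supp (mod2 (val a)) = (t i \in supp (mod2 (val a))).
  by rewrite -{1}(tt i) mem_imset //; exact: perm_inj.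
by rewrite !inE !mxE !mod2_eq0 !dvdzE !dvdn2 !negbK.
Qed.

End CodeLatticeForm.

Lemma eqz_mod4_dvd (x : int) (n : nat) :
  (x = n%:Z %[mod 4])%Z -> (4 %| x)%Z = (n == 0 %[mod 4])%N.
Proof. by move=> E; rewrite (sameP dvdz_mod0P eqP) E modz_nat mod0n. Qed.

(** Injectivity of [f] prevents distinct terms from landing on the same basis element. *)
Lemma mcoeff_sumU (K : choiceType) (G : zmodType) (F : K -> G) (f : K -> K)
    (d : {fset K}) (a : K) : injective f ->
  (\sum_(b <- d) << F b *g f b >>)@_(f a) = if a \in d then F a else 0.
Proof.
move=> f_inj; rewrite raddf_sum /=.
have [ad|ad] := boolP (a \in d).
  rewrite (big_fsetD1 a ad) /= mcoeffUU big1_seq ?addr0 // => b.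
  rewrite in_fsetD1 => /andP[_ /andP[ba _]].
  by rewrite mcoeffU (inj_eq f_inj) (negPf ba).
rewrite big1_seq // => b /= bd; rewrite mcoeffU (inj_eq f_inj).
by case: eqP bd ad => // ->  ->.
Qed.

(** * Powers of the lift and their orders *)

Section Lift.
Variables (R : realType) (N : nat) (C : {vspace 'rV['F_2]_N}).
Local Notation L := (code_lattice C).
Variables (s : 'S_N) (Hs : is_code_aut C s) (u : L -> R[i]).
Local Notation g := (code_iota Hs).
Local Notation lift := (voa_lift Hs u).

Lemma code_iota_inj : injective g.
Proof.
move=> a b /(congr1 val) /= /rowP E; apply/val_inj/rowP => i.
by have := E (s i); rewrite !mxE permK.
Qed.

Lemma voa_liftE (v : voa R C) a :
  (lift v)@_(g a) = u a *: fock_act s v@_a.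
Proof.
rewrite /voa_lift (mcoeff_sumU (fun b => u b *: fock_act s v@_b) _ _ code_iota_inj).
have [av|av] := boolP (a \in msupp v); first by [].
rewrite (mcoeff_outdom av) fock_act0 scaler0; reflexivity.
Qed.

(** The scalar collected by e_a in the [k]-th power of the lift; for [k] the order of [g] it is
    U(a). *)
Definition lift_factor k a := \prod_(0 <= i < k) u (iter i g a).

Lemma lift_factorS k a :
  lift_factor k.+1 a = u (iter k g a) * lift_factor k a.
Proof. by rewrite /lift_factor big_nat_recr //= mulrC. Qed.

Lemma iter_voa_lift k (v : voa R C) a :
  (iter k lift v)@_(iter k g a) = lift_factor k a *: fock_act (s ^+ k)%g v@_a.
Proof.
rewrite -iter_fock_act; elim: k => [|k IH].
  by rewrite /lift_factor big_geq // scale1r.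
rewrite !iterS voa_liftE IH fock_actZ scalerA.
rewrite -lift_factorS; reflexivity.
Qed.

Lemma iter_voa_lift_id k : (forall a, u a != 0) -> iter k lift =1 id ->
  iter k g =1 id /\ forall a, lift_factor k a = 1.
Proof.
move=> u_neq0 lk.
(* Compare coefficients at [iter k g a] in the image of the basis vector e_a. *)
have E a : lift_factor k a = (a == iter k g a)%:R.
  apply: (@malg_scale1_inj {cmonom ('I_N * nat)%type}).
  have := congr1 (mcoeff (iter k g a)) (lk (<< 1 *g a >> : voa R C)).
  rewrite iter_voa_lift mcoeffUU fock_act_one mcoeffU; exact: id.
(* Otherwise the factor would be 0, although it is a product of nonzero scalars. *)
have gk a : a == iter k g a.
  apply: contraT => /negPf ga; have := E a; rewrite ga => /eqP.
  rewrite /lift_factor prodf_seq_eq0 => /hasP[i _] /=.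
  by rewrite (negPf (u_neq0 _)).
by split=> a; [rewrite -(eqP (gk a))|rewrite E gk].
Qed.

Lemma iter_voa_liftE k (v : voa R C) a : iter k g =1 id -> (s ^+ k = 1)%g ->
  (iter k lift v)@_a = lift_factor k a *: v@_a.
Proof.
by move=> gk sk; rewrite -[in LHS](gk a) iter_voa_lift sk fock_act1.
Qed.

Lemma lift_factor_double k a : iter k g =1 id ->
  lift_factor (2 * k) a = lift_factor k a ^+ 2.
Proof.
move=> gk; rewrite /lift_factor mul2n -addnn (@big_cat_nat _ _ _ k) ?leq_addr //=.
rewrite expr2; congr (_ * _); rewrite -{1}[k]add0n big_addn addnK.
by apply: eq_bigr => i _; rewrite iterD gk.
Qed.

Lemma voa_lift_order1 : (forall a, u a != 0) ->
  (forall a, lift_factor #[s]%g a = 1) -> has_order lift #[s]%g.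
Proof.
move=> u_neq0 U1; split=> [//||k kn lk].
  move=> v; apply/malgP => a.
  rewrite iter_voa_liftE ?expg_order //; last exact: iter_code_iota_order.
  by rewrite U1 scale1r.
have [gk _] := iter_voa_lift_id u_neq0 lk.
by have [_ _ /(_ k kn)] := code_iota_has_order Hs; apply.
Qed.

(** Signs square to 1, so exponent [2 * n] suffices. A smaller positive exponent must be a multiple
    of [n], hence [n] itself, which fails at [a0]. *)
Lemma voa_lift_order2 a0 : (forall a, u a = 1 \/ u a = -1) ->
  lift_factor #[s]%g a0 != 1 -> has_order lift (2 * #[s]%g)%N.
Proof.
move=> u_sign U1; set n := #[s]%g.
have u_neq0 a : u a != 0 by case: (u_sign a) => ->; rewrite ?oppr_eq0 oner_neq0.
have gn := iter_code_iota_order Hs; rewrite -/n in gn.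
split=> [|v|k /andP[k0 kn] lk]; first by rewrite muln_gt0 order_gt0.
  apply/malgP => a.
  rewrite iter_voa_liftE; last first.
  - by rewrite mulnC expgM expg_order expg1n.
  - by move=> b; rewrite iterM (@iter_id _ (iter n g)).
  rewrite lift_factor_double // /lift_factor -prodrXl big1 ?scale1r // => i _.
  by case: (u_sign (iter i g a)) => ->; rewrite ?sqrrN expr1n.
have [gk Uk] := iter_voa_lift_id u_neq0 lk.
have /dvdnP[q kE] := has_order_dvd (code_iota_has_order Hs) gk.
move: k0 kn; rewrite kE ltn_mul2r muln_gt0 -/n => /andP[q0 _] /andP[_ q2].
have q1 : q = 1%N by case: q q0 q2 {kE} => [|[|]].
by move: U1; rewrite -/n -(mul1n n) -q1 -kE Uk eqxx.
Qed.

End Lift.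

(** Reflection pairs the terms above the middle index with those below it. *)
Lemma palindromic_sum (f : nat -> int) h : (0 < h)%N ->
  (forall i, (i <= h.*2)%N -> f (h.*2 - i)%N = f i) ->
  \sum_(1 <= i < h.*2) f i = f h + 2 * \sum_(1 <= i < h) f i.
Proof.
move=> h0 fsym; have hh : (h < h.*2)%N by rewrite -addnn -{1}[h]addn0 ltn_add2l.
rewrite (@big_cat_nat _ _ _ h) ?(ltnW hh) //= [X in _ + X]big_ltn //.
suff -> : \sum_(h.+1 <= i < h.*2) f i = \sum_(1 <= i < h) f i.
  by rewrite mulrDl !mul1r addrCA.
have hK : (h.*2 - h = h)%N by rewrite -addnn addnK.
rewrite big_nat_rev -{1}add1n big_addn hK; apply: eq_big_nat => i /andP[_ ih].
have ih2 : (i <= h.*2)%N by rewrite (leq_trans (ltnW ih)) ?(ltnW hh).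
by rewrite -[RHS]fsym // addSn subSS [(i + h)%N]addnC subnDl.
Qed.

Lemma exprN1z_eq1 (F : numDomainType) (n : int) :
  ((-1) ^ n == 1 :> F) = ~~ odd `|n|.
Proof.
rewrite expN1r -signr_odd; case: odd; last by rewrite expr0 eqxx.
by rewrite expr1 eq_sym -addr_eq0 -[1 + 1]/(2%:R) pnatr_eq0.
Qed.

(** * The sign U(a) of the standard lift *)

Section StandardLift.
Variables (R : realType) (N : nat) (C : {vspace 'rV['F_2]_N}).
Local Notation L := (code_lattice C).
Variables (C_dual : self_dual C) (s : 'S_N) (Hs : is_code_aut C s).
Variables (eps : L -> L -> R[i]) (eps_cocycle : lattice_cocycle eps).
Variables (u : L -> R[i]) (u_lift : is_lift_data eps Hs u).
Hypotheses (u_standard : is_standard Hs u) (s_even : ~~ odd #[s]%g).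
Local Notation g := (code_iota Hs).
Local Notation m := #[s]%g.

(* <a, g^i a> = <a, g^(m-i) a>, so up to even integers only the middle term of
   the pairing of a with its other translates survives. *)
Lemma int_form_orbit_mod4 a :
  (4 %| int_form a (\sum_(1 <= i < m) iter i g a))%Z
  = (4 %| int_form a (iter m./2 g a))%Z.
Proof.
have mE : m = m./2.*2 by rewrite even_halfK.
have h0 : (0 < m./2)%N.
  by rewrite half_gt0 ltn_neqAle order_gt0 andbT; case: eqP s_even => // <-.
rewrite int_form_sumr {1}mE palindromic_sum // => [|i im].
  rewrite rpredDr //; set S := \sum_(_ <= _ < _) _.
  have S_even : (2 %| S)%Z by apply: rpred_sum => i _; exact: int_form_even.
  exact: (dvdz_mul (dvdzz 2) S_even).
(* Applying g^i to both arguments sends g^(m-i) a to g^m a = a, which gives the palindromic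
   symmetry. *)
rewrite -(int_form_iter Hs i) -iterD subnKC // -mE int_formC.
by rewrite (iter_code_iota_order Hs).
Qed.

Lemma lift_factor_eq1 a :
  (lift_factor Hs u m a == 1) = (4 %| int_form a (iter m./2 g a))%Z.
Proof.
have [eps_neq0 eps0 epsA epsC] := eps_cocycle.
have [u_sign uM] := u_lift.
have u_neq0 b : u b != 0 by case: (u_sign b) => ->; rewrite ?oppr_eq0 oner_neq0.
rewrite /lift_factor (standard_lift_power (@code_iotaD _ _ _ Hs) eps_neq0 eps0 epsA
  u_neq0 uM (order_gt0 s) (iter_code_iota_order Hs a) u_standard).
rewrite -int_form_orbit_mod4; set T := \sum_(_ <= _ < _) _.
have /dvdzP[n nE] := int_form_even C_dual a T.
(* Here [n] is the lattice pairing of [a] with [T], so the commutator is (-1)^n, and [n] is even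
   exactly when 4 divides [int_form a T], that is [n * 2]. *)
rewrite (epsC a T n) ?mulfK // ?exprN1z_eq1.
  rewrite nE [RHS](_ : _ = (2 * 2 %| n * 2)%Z) // dvdz_mul2r //.
  by rewrite dvdzE dvdn2.
by rewrite latt_formE nE intrM mulfK.
Qed.

End StandardLift.

(** * The criterion on codewords *)

Theorem theorem8p4 (R : realType) (N : nat) (C : {vspace 'rV['F_2]_N})
  (C_even : doubly_even C) (C_dual : self_dual C)
  (gbar : 'S_N) (gbar_aut : is_code_aut C gbar)
  (m : nat) (gbar_order : #[gbar]%g = m) (m_even : ~~ odd m)
  (eps : code_lattice C -> code_lattice C -> R[i])
  (eps_cocycle : lattice_cocycle eps)
  (u : code_lattice C -> R[i])
  (u_lift : is_lift_data eps gbar_aut u)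
  (u_standard : is_standard gbar_aut u) :
  (~ order_doubling gbar_aut u <->
     forall B : 'rV['F_2]_N, B \in C ->
       (#|supp B :&: (gbar ^+ m./2)%g @: supp B| = 0 %[mod 4])%N)
  /\ (~ order_doubling gbar_aut u <-> has_order (voa_lift gbar_aut u) m)
  /\ (order_doubling gbar_aut u <-> has_order (voa_lift gbar_aut u) (2 * m)%N).
Proof.
subst m; set m := #[gbar]%g.
have gm : has_order (code_iota gbar_aut) m := code_iota_has_order gbar_aut.
have m0 : (0 < m)%N := order_gt0 gbar.
have u_sign := u_lift.1.
have u_neq0 b : u b != 0 by case: (u_sign b) => ->; rewrite ?oppr_eq0 oner_neq0.
have doublingE : order_doubling gbar_aut u <-> has_order (voa_lift gbar_aut u) (2 * m)%N.
  split=> [[n [gn ln]]|l2]; last by exists m.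
  by rewrite (has_order_uniq gm gn).
have h2 : ((gbar ^+ m./2) ^+ 2 = 1)%g.
  by rewrite -expgM muln2 even_halfK // expg_order.
pose card_mod4 B := #|supp B :&: (gbar ^+ m./2)%g @: supp B| == 0 %[mod 4].
have factorE a : (lift_factor gbar_aut u m a == 1) = card_mod4 (mod2 (val a)).
  rewrite (lift_factor_eq1 C_dual eps_cocycle u_lift u_standard m_even).
  exact: eqz_mod4_dvd (int_form_involution gbar_aut a h2).
have m_neq : m <> (2 * m)%N.
  rewrite mul2n -addnn -[LHS]addn0 => /addnI/esym/eqP.
  by rewrite -leqn0 leqNgt m0.
(* There are finitely many binary words, so the congruence is decidable and its failure yields an
   explicit codeword. Each case fixes the order of the lift, [m] or [2 * m]. *)
have [cond|ncond] := boolP [forall B, (B \in C) ==> card_mod4 B].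
  have l1 : has_order (voa_lift gbar_aut u) m.
    apply: voa_lift_order1 => // a; apply/eqP; rewrite factorE.
    exact: (implyP (forallP cond _) (valP a)).
  have nd : ~ order_doubling gbar_aut u.
    by move/doublingE => /(has_order_uniq l1).
  split; last by split=> //; split.
  by split=> // _ B BC; apply/eqP/(implyP (forallP cond B)).
have [B BC nB] : exists2 B, B \in C & ~~ card_mod4 B.
  move: ncond; rewrite negb_forall => /existsP[B].
  by rewrite negb_imply => /andP[]; exists B.
(* The 0/1 representative of [B] is a lattice vector whose sign is not 1. *)
pose b : 'rV[int]_N := \row_i (B 0 i != 0)%:R.
have bB : mod2 b = B.
  apply/rowP => i; rewrite !mxE.
  by case: (B 0 i) => -[|[|]] //= ?; apply/val_inj.
have bC : b \in in_code_lattice C by rewrite /in_code_lattice unfold_in bB.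
have l2 : has_order (voa_lift gbar_aut u) (2 * m)%N.
  apply: (@voa_lift_order2 _ _ _ _ _ _ (CodeLattice bC)) => //.
  by rewrite factorE /= bB.
have d : order_doubling gbar_aut u by apply/doublingE.
split; last split=> //.
  by split=> // /(_ B BC) /eqP; rewrite -/(card_mod4 B) (negPf nB).
by split=> // l1; case: m_neq; exact: has_order_uniq l1 l2.
Qed.
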